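(* Let $(X,d)$ be a finite subset of $(\mathbb R^n,\|\cdot\|_1)$ with at least two points, with distance matrix $D_X$. Then $D_X$ is invertible if and only if $(X,d)$ is of strict $1$-negative type.
   Context: Here $d(\boldsymbol x,\boldsymbol y)=\|\boldsymbol x-\boldsymbol y\|_1$. For a finite metric space with distinct points $x_0,\dots,x_m$, the distance matrix is $D_X=(d(x_i,x_j))_{i,j=0}^m$. The space is of strict $1$-negative type if $\sum_{i,j}d(x_i,x_j)\xi_i\xi_j<0$ for every nonzero $\boldsymbol\xi=(\xi_0,\dots,\xi_m)^T\in\mathbb R^{m+1}$ with $\sum_i\xi_i=0$. *)

(* Defs.v *)
From HB Require Import structures.
From mathcomp Require Import all_boot all_order all_algebra.
From mathcomp Require Import reals.

Set Implicit Arguments.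
Unset Strict Implicit.
Unset Printing Implicit Defensive.

Import Order.TTheory GRing.Theory Num.Theory.

Local Open Scope ring_scope.

(* MathComp-Analysis equips 'rV[R]_n with the sup norm, so the l1 distance is
   written out here. *)
Definition l1dist (R : realType) (n : nat) (x y : 'rV[R]_n) : R :=
  \sum_(k < n) `|x 0 k - y 0 k|.

(* A finite metric space {x_0, ..., x_m} is given by a distance d on an ambient
   type T and a family x of points; distinctness of the points (injectivity of
   x) is assumed where these notions are used. *)
Definition distance_mx (R : realType) (T : Type) (d : T -> T -> R) (m : nat)
    (x : 'I_m.+1 -> T) : 'M[R]_m.+1 :=
  \matrix_(i, j) d (x i) (x j).

Definition strict_1_negative_type (R : realType) (T : Type) (d : T -> T -> R)
    (m : nat) (x : 'I_m.+1 -> T) : Prop :=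
  forall xi : 'cV[R]_m.+1, xi != 0 -> \sum_i xi i 0 = 0 ->
    \sum_i \sum_j d (x i) (x j) * xi i 0 * xi j 0 < 0.

(* Main.v *)
Require Import Defs.
From HB Require Import structures.
From mathcomp Require Import all_boot all_order all_algebra.
From mathcomp Require Import reals.
From mathcomp Require Import ring lra.

Set Implicit Arguments.
Unset Strict Implicit.
Unset Printing Implicit Defensive.

Import Order.TTheory GRing.Theory Num.Theory.

Local Open Scope ring_scope.

(** Write [q] for the quadratic form of the distance matrix [D] and [H] for the
    hyperplane of vectors with zero coordinate sum.

    If [q] is negative definite on [H], a kernel vector of [D] cannot lie in
    [H]; if it lay outside [H], then together with [H] it would span the whole
    space, and [q] would be nonpositive everywhere. But [q] takes the positive
    value [2 d(x_0, x_1)] at [e_0 + e_1]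
    ([unitmx_of_neg_definite_hyperplane]).

    Conversely, the l1 metric is the sum over the coordinates [k] of metrics of
    points on a line, so [D] is the sum of matrices [D_k], each of which is
    nonpositive on [H] ([line_negative_type]). If [q] vanishes at [xi] in [H],
    then so does the form of every [D_k], and the Cauchy-Schwarz argument makes
    [D_k xi] a constant vector. Its value at the leftmost point of the line is
    the opposite of its value at the rightmost point, because [xi] has zero sum;
    hence [D_k xi = 0] ([line_potential_eq0]). Summing over [k] gives
    [D xi = 0], so [xi = 0] when [D] is invertible. This last step is special to
    l1: in a general metric space of negative type the vector [D xi] need only
    be constant. *)

(** * Bilinear forms on the hyperplane of vectors with zero sum *)

Definition bilform (R : pzRingType) (n : nat) (A : 'M[R]_n) (u v : 'cV[R]_n) : R :=
  (u^T *m A *m v) 0 0.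

Definition zero_sum (R : pzRingType) (n : nat) (u : 'cV[R]_n) : Prop :=
  \sum_i u i 0 = 0.

Section BilinearForm.
Variables (R : realFieldType) (n : nat).
Implicit Types (A : 'M[R]_n) (u v w : 'cV[R]_n).

Lemma bilform_sum A u v :
  bilform A u v = \sum_i \sum_j A i j * u i 0 * v j 0.
Proof.
rewrite /bilform -mulmxA mxE; apply: eq_bigr => i _.
rewrite !mxE mulr_sumr; apply: eq_bigr => j _; ring.
Qed.

Lemma bilformDl A u v w : bilform A (u + v) w = bilform A u w + bilform A v w.
Proof. by rewrite /bilform linearD !mulmxDl mxE. Qed.

Lemma bilformDr A u v w : bilform A w (u + v) = bilform A w u + bilform A w v.
Proof. by rewrite /bilform mulmxDr mxE. Qed.

Lemma bilformZl A a u v : bilform A (a *: u) v = a * bilform A u v.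
Proof. by rewrite /bilform linearZ -!scalemxAl mxE. Qed.

Lemma bilformZr A a u v : bilform A u (a *: v) = a * bilform A u v.
Proof. by rewrite /bilform -scalemxAr mxE. Qed.

Lemma bilform_sumA (I : finType) (A : I -> 'M[R]_n) u v :
  bilform (\sum_k A k) u v = \sum_k bilform (A k) u v.
Proof. by rewrite /bilform mulmx_sumr mulmx_suml summxE. Qed.

Lemma bilform_sym A u v : A^T = A -> bilform A u v = bilform A v u.
Proof.
by move=> symA; rewrite /bilform -[in LHS](trmxK (_ *m v)) mxE !trmx_mul symA trmxK mulmxA.
Qed.

Lemma bilform_delta A i v : bilform A (delta_mx i 0) v = (A *m v) i 0.
Proof. by rewrite /bilform trmx_delta -rowE -row_mul mxE. Qed.

Lemma bilform_delta2 A i j : bilform A (delta_mx i 0) (delta_mx j 0) = A i j.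
Proof. by rewrite bilform_delta -colE mxE. Qed.

Lemma zero_sum_delta (i j : 'I_n) :
  zero_sum (delta_mx i 0 + (- 1) *: delta_mx j 0 : 'cV[R]_n).
Proof.
have sum1 k : \sum_l (delta_mx k 0 : 'cV[R]_n) l 0 = 1.
  rewrite (bigD1 k) //= big1 ?mxE ?eqxx ?addr0 // => l /negPf lk.
  by rewrite mxE lk.
rewrite /zero_sum.
under eq_bigr => l _ do rewrite mxE [X in _ + X]mxE.
by rewrite big_split -mulr_sumr /= !sum1; ring.
Qed.

Lemma unitmx_ker0 A :
  A^T = A -> A \in unitmx <-> (forall v, A *m v = 0 -> v = 0).
Proof.
move=> symA; split=> [Au v Av0 | kerA0]; first by rewrite -(mulKmx Au v) Av0 mulmx0.
rewrite unitmxE unitfE; apply/negP => /det0P [v v0 vA].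
move: v0; rewrite -[v]trmxK (kerA0 v^T) ?trmx0 ?eqxx //.
by rewrite -[LHS]trmxK trmx_mul trmxK symA vA trmx0.
Qed.

(** The equality case of the Cauchy-Schwarz inequality: for [v] in the
    hyperplane, the value of the form at [v + t u] is affine in [t] with slope
    [2 bilform A u v], and bounded above, so the slope is zero. Taking for [v]
    a difference of two basis vectors compares two coordinates of [A u]. *)
Lemma isotropic_mulmx_const A u :
    A^T = A -> (forall v, zero_sum v -> bilform A v v <= 0) ->
    zero_sum u -> bilform A u u = 0 ->
  forall i j, (A *m u) i 0 = (A *m u) j 0.
Proof.
move=> symA A_le0 u0 Auu i j.
suff A_u v : zero_sum v -> bilform A v u = 0.
  have := A_u _ (zero_sum_delta i j).
  rewrite bilformDl bilformZl !bilform_delta mulN1r => /eqP.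
  by rewrite subr_eq0 => /eqP.
move=> v0; apply/eqP/negP => /negP Avu.
(* The affine function of the parameter takes the value 1 at [t]. *)
pose t := (1 - bilform A v v) / (2 * bilform A v u).
have /A_le0 : zero_sum (v + t *: u).
  rewrite /zero_sum; under eq_bigr => k _ do rewrite mxE [X in _ + X]mxE.
  by rewrite big_split -mulr_sumr /= v0 u0 mulr0 addr0.
have -> : bilform A (v + t *: u) (v + t *: u) = 1.
  rewrite !(bilformDl, bilformDr, bilformZl, bilformZr) Auu (bilform_sym u v symA).
  by rewrite /t; field.
by rewrite ler10.
Qed.

(** A kernel vector outside the hyperplane can be subtracted from any [w] to
    bring it into the hyperplane without changing the value of the form. *)
Lemma unitmx_of_neg_definite_hyperplane A w :
    A^T = A -> (forall v, v != 0 -> zero_sum v -> bilform A v v < 0) ->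
    0 < bilform A w w ->
  A \in unitmx.
Proof.
move=> symA A_lt0 Aww; apply/(unitmx_ker0 symA) => u Au0.
apply/eqP/negP => /negP u0.
have Au v : bilform A v u = 0 by rewrite /bilform -mulmxA Au0 mulmx0 mxE.
have su0 : \sum_i u i 0 != 0.
  by apply/eqP => /(A_lt0 _ u0); rewrite Au ltxx.
pose t := - (\sum_i w i 0) / \sum_i u i 0.
have : zero_sum (w + t *: u).
  rewrite /zero_sum; under eq_bigr => k _ do rewrite mxE [X in _ + X]mxE.
  by rewrite big_split -mulr_sumr /= /t; field.
have E : bilform A (w + t *: u) (w + t *: u) = bilform A w w.
  rewrite !(bilformDl, bilformDr, bilformZl, bilformZr) (bilform_sym u w symA) !Au.
  by ring.
have [wu0 | wu0] := eqVneq (w + t *: u) 0.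
  by move: Aww; rewrite -E wu0 /bilform mulmx0 mxE ltxx.
by move=> /(A_lt0 _ wu0); rewrite E ltNge ltW.
Qed.

End BilinearForm.

(** * Points on a line *)

Section Line.
Variable R : realType.

(** Peeling off the smallest positive value [c] of [a]: on the support [S] of
    [a], [min (a i) (a j)] is [c] plus the same kernel for [a - c], and the
    constant kernel [c] on [S] contributes [c] times the square of the sum of
    [xi] over [S]. The support of what remains is smaller. *)
Lemma min_kernel_ge0 (I : finType) (a xi : I -> R) :
  (forall i, 0 <= a i) ->
  0 <= \sum_i \sum_j Num.min (a i) (a j) * xi i * xi j.
Proof.
have [k] := ubnP #|[set i | a i != 0]|.
elim: k => // k IHk in a *; rewrite ltnS => card_a a_ge0.
case: (pickP [pred i | a i != 0]) => [i0 /= ai0 | a0]; last first.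
  rewrite big1 // => i _; rewrite big1 // => j _.
  by rewrite (eqP (negbFE (a0 i))) (eqP (negbFE (a0 j))) minxx !mul0r.
case: (arg_minP (P := fun i => a i != 0) a ai0) => c0 ac0 a_min; set c := a c0.
pose s i : R := (a i != 0)%:R; pose b i := a i - c * s i.
have c_ge0 : 0 <= c := a_ge0 c0.
have b_ge0 i : 0 <= b i.
  rewrite /b /s; case: eqP => [-> | /eqP /a_min]; first by rewrite mulr0 subr0.
  by rewrite mulr1 subr_ge0.
have min_ab i j : Num.min (a i) (a j) = c * s i * s j + Num.min (b i) (b j).
  have bi := b_ge0 i; have bj := b_ge0 j; move: bi bj; rewrite /b /s.
  have := a_ge0 i; have := a_ge0 j.
  case: (eqVneq (a i) 0) => [->|_]; case: (eqVneq (a j) 0) => [->|_];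
    rewrite ?mulr0 ?mulr1 ?mul0r ?subr0 ?add0r //= => aj ai bi bj.
  - by rewrite !min_l.
  - by rewrite !min_r.
  - by rewrite addr_minr ![c + _]addrC !subrK.
have -> : \sum_i \sum_j Num.min (a i) (a j) * xi i * xi j =
    c * (\sum_i s i * xi i) ^+ 2 +
    \sum_i \sum_j Num.min (b i) (b j) * xi i * xi j.
  rewrite expr2 mulr_suml mulr_sumr -big_split; apply: eq_bigr => i _ /=.
  rewrite !mulr_sumr -big_split; apply: eq_bigr => j _ /=.
  by rewrite min_ab; ring.
apply: addr_ge0; first by rewrite mulr_ge0 ?sqr_ge0.
apply: IHk => //; apply: leq_trans card_a.
apply/proper_card/properP; split.
  apply/subsetP => i; rewrite !inE /b /s.
  by apply: contraNneq => ->; rewrite eqxx mulr0 subr0.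
by exists c0; rewrite !inE // /b /s ac0 mulr1 subrr eqxx.
Qed.

Variable m : nat.
Implicit Types (t : 'I_m.+1 -> R) (xi : 'cV[R]_m.+1).

Definition line_mx t : 'M[R]_m.+1 := distance_mx (fun a b : R => `|a - b|) t.

Lemma line_mx_sym t : (line_mx t)^T = line_mx t.
Proof. by apply/matrixP => i j; rewrite !mxE distrC. Qed.

(** With the origin at the leftmost point, [|a - b| = a + b - 2 min(a, b)], and
    on vectors with zero sum the terms [a] and [b] disappear. *)
Lemma line_negative_type t xi :
  zero_sum xi -> bilform (line_mx t) xi xi <= 0.
Proof.
move=> xi0; case: (@arg_minP _ _ _ ord0 xpredT t isT) => l _ t_min.
pose a i := t i - t l.
have a_ge0 i : 0 <= a i by rewrite subr_ge0 t_min.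
have ge0 := min_kernel_ge0 (fun i => xi i 0) a_ge0.
suff -> : bilform (line_mx t) xi xi =
    - (2 * \sum_i \sum_j Num.min (a i) (a j) * xi i 0 * xi j 0).
  by rewrite oppr_le0 mulr_ge0.
have dist_min i j : `|t i - t j| = a i + a j - 2 * Num.min (a i) (a j).
  rewrite /a; case: (leP (t i - t l) (t j - t l)) => tij.
    by rewrite ler0_norm; lra.
  by rewrite ger0_norm; lra.
have -> : bilform (line_mx t) xi xi =
    (\sum_i a i * xi i 0) * (\sum_j xi j 0) +
    (\sum_i xi i 0) * (\sum_j a j * xi j 0) -
    2 * \sum_i \sum_j Num.min (a i) (a j) * xi i 0 * xi j 0.
  rewrite bilform_sum !mulr_suml mulr_sumr -big_split -sumrB; apply: eq_bigr => i _ /=.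
  rewrite !mulr_sumr -big_split -sumrB; apply: eq_bigr => j _ /=.
  by rewrite mxE dist_min; ring.
by rewrite xi0; ring.
Qed.

(** The vector [line_mx t *m xi] is constant. At the rightmost point [r] and the
    leftmost point [l] all the absolute values open with one sign, so for [xi]
    of zero sum its entries there are minus and plus the sum of the
    [t j * xi j 0]. *)
Lemma line_potential_eq0 t xi :
  zero_sum xi -> bilform (line_mx t) xi xi = 0 -> line_mx t *m xi = 0.
Proof.
move=> xi0 xi_iso.
have const := isotropic_mulmx_const (line_mx_sym t) (@line_negative_type t) xi0 xi_iso.
case: (@arg_minP _ _ _ ord0 xpredT t isT) => l _ t_min.
case: (@arg_maxP _ _ _ ord0 xpredT t isT) => r _ t_max.
pose M := \sum_j t j * xi j 0.
have at_l : (line_mx t *m xi) l 0 = M.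
  have -> : M = M - t l * \sum_j xi j 0 by rewrite xi0 mulr0 subr0.
  rewrite mxE mulr_sumr -sumrB; apply: eq_bigr => j _.
  by rewrite mxE distrC ger0_norm ?subr_ge0 ?t_min // mulrBl.
have t_le_r j : t j <= t r by exact: t_max.
have at_r : (line_mx t *m xi) r 0 = - M.
  have -> : - M = t r * (\sum_j xi j 0) - M by rewrite xi0 mulr0 sub0r.
  rewrite mxE mulr_sumr -sumrB; apply: eq_bigr => j _.
  by rewrite mxE ger0_norm ?subr_ge0 ?t_le_r // mulrBl.
have M0 : M = 0 by have := const l r; rewrite at_l at_r; lra.
by apply/colP => i; rewrite (const i l) at_l M0 mxE.
Qed.

End Line.

(** * Points in l1 *)

Section L1.
Variables (R : realType) (n m : nat) (x : 'I_m.+1 -> 'rV[R]_n).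

Lemma l1_mx_sum_line :
  distance_mx (@l1dist R n) x = \sum_k line_mx (fun i => x i 0 k).
Proof.
by apply/matrixP => i j; rewrite mxE summxE; apply: eq_bigr => k _; rewrite mxE.
Qed.

Lemma l1_mx_sym : (distance_mx (@l1dist R n) x)^T = distance_mx (@l1dist R n) x.
Proof.
by rewrite l1_mx_sum_line linear_sum; apply: eq_bigr => k _; apply: line_mx_sym.
Qed.

(** A sum of nonpositive numbers vanishes only termwise, so an isotropic vector
    of the l1 form is isotropic for the line of each coordinate. *)
Lemma l1_potential_eq0 (xi : 'cV[R]_m.+1) :
    zero_sum xi -> 0 <= bilform (distance_mx (@l1dist R n) x) xi xi ->
  distance_mx (@l1dist R n) x *m xi = 0.
Proof.
move=> xi0; rewrite l1_mx_sum_line bilform_sumA => ge0.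
have le0 k : bilform (line_mx (fun i => x i 0 k)) xi xi <= 0.
  exact: line_negative_type.
rewrite mulmx_suml big1 // => k _; apply: line_potential_eq0 => //.
apply/eqP; rewrite eq_le le0 /=; apply: le_trans ge0 _.
by rewrite (bigD1 k) //= gerDl sumr_le0.
Qed.

End L1.

Lemma l1dist_ge0 (R : realType) (n : nat) (y z : 'rV[R]_n) : 0 <= l1dist y z.
Proof. exact: sumr_ge0. Qed.

Lemma l1dist_gt0 (R : realType) (n : nat) (y z : 'rV[R]_n) :
  y != z -> 0 < l1dist y z.
Proof.
move=> yz; rewrite lt_def l1dist_ge0 andbT; apply: contraNneq yz => /eqP.
rewrite psumr_eq0 // => /allP d0; apply/eqP/rowP => k.
by apply/eqP; rewrite -subr_eq0 -normr_eq0; apply: d0; rewrite mem_index_enum.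
Qed.

Theorem theorem2p9 (R : realType) (n m : nat) (x : 'I_m.+1 -> 'rV[R]_n)
    (x_inj : injective x) (two_points : (1 < m.+1)%N) :
  distance_mx (@l1dist R n) x \in unitmx <->
  strict_1_negative_type (@l1dist R n) x.
Proof.
set D := distance_mx _ x.
have form_sum (xi : 'cV[R]_m.+1) :
    \sum_i \sum_j l1dist (x i) (x j) * xi i 0 * xi j 0 = bilform D xi xi.
  rewrite bilform_sum; apply: eq_bigr => i _; apply: eq_bigr => j _.
  by rewrite mxE.
split=> [D_unit xi xi_neq0 xi0 | D_neg].
  rewrite form_sum ltNge; apply: contraNN xi_neq0 => ge0; apply/eqP.
  exact: (proj1 (unitmx_ker0 (l1_mx_sym x)) D_unit) (l1_potential_eq0 xi0 ge0).
pose p : 'I_m.+1 := Ordinal two_points.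
apply: (@unitmx_of_neg_definite_hyperplane _ _ _ (delta_mx ord0 0 + delta_mx p 0)).
- exact: l1_mx_sym.
- by move=> v v_neq0 v0; rewrite -form_sum; apply: D_neg.
have D_gt0 : 0 < D ord0 p by rewrite mxE l1dist_gt0 // (inj_eq x_inj).
have D_ge0 i j : 0 <= D i j by rewrite mxE l1dist_ge0.
rewrite !(bilformDl, bilformDr) !bilform_delta2.
by have := D_ge0 ord0 ord0; have := D_ge0 p ord0; have := D_ge0 p p; lra.
Qed.
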